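(* Let $D$ be a digraph such that $\mathsf{d}_s^-(D)\ge 2$ and $D-a$ is strong for every $a\in A(D)$. The following are equivalent: (a) $D$ is a strong in-domatic critical digraph; (b) every strong in-domatic partition $\mathfrak{S}=\{S_1,\dots,S_k\}$ of $V(D)$ with $k=\mathsf{d}_s^-(D)$ satisfies (b.1) $D\langle S_i\rangle-a$ is not strong for every $i\in\{1,\dots,k\}$ and every arc $a$ of $D\langle S_i\rangle$, and (b.2) $|S_i\cap N^+(u)|=1$ for every $i\in\{1,\dots,k\}$ and every $u\in V(D)\setminus S_i$.
   Context: Digraphs are finite, loopless, without parallel arcs. A digraph is strong if for every ordered pair $u,v$ there is a directed $uv$-walk. $N^+(u)$ is the set of out-neighbors of $u$. $S\subseteq V(D)$ is in-dominating if every vertex not in $S$ has an out-neighbor in $S$; strong in-dominating if moreover the induced subdigraph $D\langle S\rangle$ is strong. A strong in-domatic partition is a partition of $V(D)$ into strong in-dominating sets; $\mathsf{d}_s^-(D)$ is the maximum number of its classes. $D$ is a strong in-domatic critical digraph if for every arc $a$ of $D$, $D-a$ is strong and $\mathsf{d}_s^-(D-a)=\mathsf{d}_s^-(D)-1$. *)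

(* Defs.v *)
From mathcomp Require Import all_boot.

Set Implicit Arguments.
Unset Strict Implicit.
Unset Printing Implicit Defensive.

(* Parallel arcs are excluded by encoding the arcs as a relation. *)
Record digraph := Digraph {
  vertex :> finType;
  adj : rel vertex;
  adj_irrefl : irreflexive adj
}.

Definition arcs (D : digraph) : {set D * D} := [set a | adj a.1 a.2].

Definition out_nbrs (D : digraph) (u : D) : {set D} := [set v | adj u v].

(* [connect e u v] holds iff there is an [e]-walk, possibly of length 0, from
   [u] to [v]; so a one-vertex digraph is strong. *)
Definition strong (D : digraph) : bool :=
  [forall u : D, forall v : D, connect (@adj D) u v].

Definition del_adj (D : digraph) (a : D * D) : rel D :=
  [rel u v | adj u v && ((u, v) != a)].

Lemma del_adj_irrefl (D : digraph) (a : D * D) : irreflexive (del_adj a).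
Proof. by move=> u; rewrite /del_adj /= adj_irrefl. Qed.

Definition del_arc (D : digraph) (a : D * D) : digraph :=
  Digraph (@del_adj_irrefl D a).

Definition induced_adj (D : digraph) (S : {set D}) : rel {u : D | u \in S} :=
  [rel u v | adj (val u) (val v)].

Lemma induced_adj_irrefl (D : digraph) (S : {set D}) :
  irreflexive (@induced_adj D S).
Proof. by move=> u; apply: adj_irrefl. Qed.

Definition induced (D : digraph) (S : {set D}) : digraph :=
  Digraph (@induced_adj_irrefl D S).

Definition in_dominating (D : digraph) (S : {set D}) : bool :=
  [forall (u | u \notin S), exists v in S, adj u v].

Definition strong_in_dominating (D : digraph) (S : {set D}) : bool :=
  in_dominating S && strong (induced S).

(* [partition] requires the classes to be nonempty. *)
Definition strong_in_domatic_partition (D : digraph) (P : {set {set D}}) :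
  bool :=
  partition P [set: D] && [forall S in P, strong_in_dominating S].

(* The maximum is over a nonempty family as soon as [D] is strong and nonempty,
   since [[set [set: D]]] then qualifies; it is 0 by convention when there is
   no strong in-domatic partition. *)
Definition strong_in_domatic_number (D : digraph) : nat :=
  \max_(P : {set {set D}} | strong_in_domatic_partition P) #|P|.

(* The truncated subtraction is harmless: an arc makes [D] nonempty, and
   strongness of [del_arc a] makes [D] strong, so the number of [D] is
   positive. *)
Definition strong_in_domatic_critical (D : digraph) : Prop :=
  forall a : D * D, a \in arcs D ->
    strong (del_arc a) /\
    strong_in_domatic_number (del_arc a) = strong_in_domatic_number D - 1.

(* Main.v *)
Require Import Defs.
From mathcomp Require Import all_boot.

(** Deleting an arc cannot increase the strong in-domatic number; the crux is
    that, when [D - a] is strong, it decreases it by at most one.  Let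
    [a = (x, y)] and let [P] be an optimal partition, [A] the class of [y].
    If [x] lies outside [A], only the domination of [x] by [A] can be lost, and
    merging [A] with a class avoiding [x] repairs it (if there is none, the
    trivial partition has enough classes).  If [x] lies in [A] and [A] is no
    longer strong, the set [W] of the vertices of [A] still reaching [y] inside
    [A] is entered, as [D - a] is strong, by an arc coming from another class
    [B]; then [x] reaches [y] through [B], and [A :|: B] is strong.
    Hence [D] is critical iff no optimal partition survives the deletion of an
    arc, and (b.1) and (b.2) say exactly this for the arcs inside a class and
    between two classes. *)

Set Implicit Arguments.
Unset Strict Implicit.
Unset Printing Implicit Defensive.

(** * Walks, domination and strength for relations on a finite type *)

Section Relations.

Variable T : finType.
Implicit Types (e r : rel T) (A B S W : {set T}) (P : {set {set T}}).
Implicit Types (a : T * T).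

(** Kept on the whole type, so that walks inside different vertex sets compose without moving
    between subtypes. *)
Definition restrict e S : rel T := fun u v => [&& u \in S, v \in S & e u v].

Definition strong_on e S := {in S &, forall u v, connect (restrict e S) u v}.

Definition dominated_by e S := forall u, u \notin S -> exists2 v, v \in S & e u v.

Definition remove e a : rel T := fun u v => e u v && ((u, v) != a).

Lemma connect_restrictS e A B u v :
  A \subset B -> connect (restrict e A) u v -> connect (restrict e B) u v.
Proof.
move=> /subsetP sAB; apply: connect_sub => w z /and3P[wA zA ewz].
by apply: connect1; rewrite /restrict !sAB.
Qed.

Lemma strong_on_sub e e' S :
  {in S &, forall u v, e u v -> e' u v} -> strong_on e S -> strong_on e' S.
Proof.
move=> ee' sS u v uS vS; apply: connect_sub (sS u v uS vS) => w z /and3P[wS zS ewz].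
by apply: connect1; rewrite /restrict wS zS ee'.
Qed.

Lemma connect_setU r A B x y z w :
  {in A &, forall u v, connect r u v} -> {in B &, forall u v, connect r u v} ->
  x \in A -> y \in B -> connect r x y -> z \in B -> w \in A -> connect r z w ->
  {in A :|: B &, forall u v, connect r u v}.
Proof.
move=> cA cB xA yB rxy zB wA rzw u v /setUP[uX|uX] /setUP[vX|vX].
- exact: cA.
- by apply: connect_trans (cA u x _ _) (connect_trans rxy (cB y v _ _)).
- by apply: connect_trans (cB u z _ _) (connect_trans rzw (cA w v _ _)).
- exact: cB.
Qed.

(** Cut a walk from [u] to [v] before its first and after its last use of the arc [(x, y)]. *)
Lemma connect_remove e x y u v : connect e u v ->
  connect (remove e (x, y)) u v \/
  connect (remove e (x, y)) u x /\ connect (remove e (x, y)) y v.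
Proof.
case/connectP=> p; elim: p u => [|w p IHp] u /= => [_ -> | /andP[euw pw] vE].
  by left.
have [[-> wy]|uw] := (u, w) =P (x, y).
  by right; split=> //; rewrite -wy; case: (IHp w pw vE) => [//|[]]; rewrite wy.
have ruw : connect (remove e (x, y)) u w.
  by apply: connect1; rewrite /remove euw; apply/eqP.
case: (IHp w pw vE) => [rwv|[rwx ryv]]; [left|right; split=> //].
  exact: connect_trans ruw rwv.
exact: connect_trans ruw rwx.
Qed.

Lemma connect_enters e W x y : connect e x y -> x \notin W -> y \in W ->
  exists z w, [/\ z \notin W, w \in W & e z w].
Proof.
case/connectP=> p; elim: p x => [|w p IHp] x /= => [_ ->|]; first by move=> /negP.
case/andP=> exw pw yE xW yW; have [wW|wW] := boolP (w \in W).
  by exists x, w.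
exact: (IHp w).
Qed.

(** Domination by [S] only uses arcs with tail outside [S] and head in [S]. *)
Lemma dominated_by_remove e S x y : (x \in S) || (y \notin S) ->
  dominated_by e S -> dominated_by (remove e (x, y)) S.
Proof.
move=> xyS dS u uS; have [v vS euv] := dS u uS; exists v => //.
rewrite /remove euv; apply/eqP=> -[ux vy]; move: xyS.
by rewrite -ux -vy (negPf uS) vS.
Qed.

Lemma strong_on_remove e S x y : ~~ ((x \in S) && (y \in S)) ->
  strong_on e S -> strong_on (remove e (x, y)) S.
Proof.
move=> xyS; apply: strong_on_sub => u v uS vS euv; rewrite /remove euv.
by apply: contra xyS => /eqP[<- <-]; rewrite uS.
Qed.

(* Every vertex of [S] still reaches [x], and is still reached from [y]. *)
Lemma connect_on_remove e S B x y : strong_on e S -> S \subset B ->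
  connect (restrict (remove e (x, y)) B) x y ->
  {in S &, forall u v, connect (restrict (remove e (x, y)) B) u v}.
Proof.
move=> sS sSB rxy u v uS vS.
have sub w z : connect (remove (restrict e S) (x, y)) w z ->
    connect (restrict (remove e (x, y)) B) w z.
  apply: connect_sub => {}w {}z /andP[/and3P[wS zS ewz] nwz]; apply: connect1.
    by apply/and3P; split; [exact: (subsetP sSB) | exact: (subsetP sSB) | apply/andP].
have [/sub //|[/sub rux /sub ryv]] := connect_remove x y (sS u v uS vS).
exact: connect_trans rux (connect_trans rxy ryv).
Qed.

Lemma partition_merge P D A B : partition P D -> A \in P -> B \in P -> A != B ->
  partition ((A :|: B) |: (P :\ A :\ B)) D /\
  #|(A :|: B) |: (P :\ A :\ B)| = #|P|.-1.
Proof.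
move=> pP AP BP AB.
have BPA : B \in P :\ A by rewrite !inE eq_sym AB.
have p2 := partitionD1 (partitionD1 pP AP) BPA.
have AB0 : A :|: B != set0.
  by rewrite setU_eq0 negb_and (partition_neq0 pP AP).
have dAB : [disjoint A :|: B & D :\: A :\: B].
  by rewrite -setI_eq0; apply/eqP/setP=> x; rewrite !inE; case: (x \in A); case: (x \in B).
have pM := partitionU1 p2 AB0 dAB; split.
  suff <- : (A :|: B) :|: (D :\: A :\: B) = D by [].
  rewrite setDDl -{2}(setID D (A :|: B)) (setIidPr _) //.
  by rewrite subUset !(partitionS pP).
rewrite cardsU1 (cardsD1 A P) AP (cardsD1 B (P :\ A)) BPA.
(* The union is not already a class: the remaining classes avoid it, and it is nonempty. So the
   count drops by exactly one. *)
suff -> : A :|: B \notin P :\ A :\ B by [].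
apply/negP=> /(partitionS p2) /subsetP sub.
by have /set0Pn[x xAB] := AB0; have := sub x xAB; move: xAB; rewrite !inE;
  case: (x \in A); case: (x \in B).
Qed.

End Relations.

(** * Translation of the digraph notions into relations *)

Lemma strong_subP (T : finType) (S : {set T}) (e : rel T) :
  (forall u v : {x | x \in S}, connect (relpre val e) u v) <-> strong_on e S.
Proof.
split=> [cS u v uS vS | sS u v].
  have /connectP[p] := cS (Sub u uS) (Sub v vS).
  rewrite -[u in connect _ u]/(val (Sub u uS : {x | x \in S})).
  elim: p (Sub u uS : {x | x \in S}) => [|w p IHp] z /= => [_ <- // | /andP[ezw pw] vE].
  by apply: connect_trans (connect1 _) (IHp w pw vE); rewrite /restrict !(valP z, valP w).
have /connectP[p] := sS _ _ (valP u) (valP v).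
elim: p u => [|w p IHp] u /= => [_ /val_inj-> // | /andP[/and3P[_ wS euw] pw] vE].
by apply: connect_trans (connect1 _) (IHp (Sub w wS) pw vE).
Qed.

Lemma strongP (D : digraph) :
  reflect (forall u v : D, connect (@adj D) u v) (strong D).
Proof. by apply: (iffP forallP) => H u; apply/forallP/H. Qed.

Lemma strong_inducedP (D : digraph) (S : {set D}) :
  reflect (strong_on (@adj D) S) (strong (induced S)).
Proof. by apply: (iffP (strongP _)) => H; apply/strong_subP. Qed.

Lemma strong_del_inducedP (D : digraph) (S : {set D}) (a : induced S * induced S) :
  reflect (strong_on (remove (@adj D) (val a.1, val a.2)) S) (strong (del_arc a)).
Proof.
have E : relpre val (remove (@adj D) (val a.1, val a.2)) =2 @adj (del_arc a).
  (* Equality in the subtype unfolds to equality of values, so both tests against [a] agree. *)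
  move=> u v /=; rewrite /induced_adj /=; congr (_ && ~~ _).
apply: (iffP (strongP _)) => [H | /strong_subP H u v].
  by apply/strong_subP=> u v; rewrite (eq_connect E).
by rewrite -(eq_connect E).
Qed.

Lemma in_dominatingP (D : digraph) (S : {set D}) :
  reflect (dominated_by (@adj D) S) (in_dominating S).
Proof. by apply: (iffP 'forall_implyP) => H u /H /exists_inP. Qed.

Lemma strong_in_domatic_partitionP (D : digraph) (P : {set {set D}}) :
  reflect (partition P [set: D] /\
           {in P, forall S, dominated_by (@adj D) S /\ strong_on (@adj D) S})
          (strong_in_domatic_partition P).
Proof.
apply: (iffP andP) => -[pP]; split=> //.
  move=> S SP; have /andP[dS sS] := forall_inP b S SP.
  by split; [apply/in_dominatingP | apply/strong_inducedP].
apply/forall_inP=> S /b [dS sS].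
by apply/andP; split; [apply/in_dominatingP | apply/strong_inducedP].
Qed.

(** * Bounds on the strong in-domatic number *)

Lemma leq_strong_in_domatic_number (D : digraph) (P : {set {set D}}) :
  strong_in_domatic_partition P -> #|P| <= strong_in_domatic_number D.
Proof. exact: leq_bigmax_cond. Qed.

Lemma strong_in_domatic_number_attained (D : digraph) :
  0 < strong_in_domatic_number D ->
  exists2 P : {set {set D}}, strong_in_domatic_partition P &
    #|P| = strong_in_domatic_number D.
Proof.
move=> d0; have [P0 P0D|noP] := pickP (@strong_in_domatic_partition D).
  have [|P PD PE] := @eq_bigmax_cond _ (@strong_in_domatic_partition D)
    (fun P => #|P|).
    by apply/card_gt0P; exists P0.
  by exists P => //; rewrite -PE.
by move: d0; rewrite /strong_in_domatic_number big_pred0.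
Qed.

Lemma strong_in_domatic_number_gt0 (D : digraph) (x : D) :
  strong D -> 0 < strong_in_domatic_number D.
Proof.
move=> /strongP sD; rewrite -(cards1 [set: D]).
apply/leq_strong_in_domatic_number/strong_in_domatic_partitionP; split.
  rewrite /partition cover1 eqxx trivIset1 /=.
  by rewrite inE eq_sym; apply/set0Pn; exists x.
move=> S /set1P->; split=> [u | u v _ _]; first by rewrite inE.
by apply: connect_sub (sD u v) => w z ewz; apply: connect1; rewrite /restrict !inE.
Qed.

(** The class [B] alone supplies domination for [A :|: B], so [A] may have lost domination, strength
    or both. *)
Lemma leq_merge_strong_in_domatic_number (D : digraph) (P : {set {set D}}) A B :
  partition P [set: D] -> A \in P -> B \in P -> A != B ->
  {in P, forall S, S != A ->
     dominated_by (@adj D) S /\ (S != B -> strong_on (@adj D) S)} ->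
  strong_on (@adj D) (A :|: B) ->
  #|P| - 1 <= strong_in_domatic_number D.
Proof.
move=> pP AP BP AB PS sAB; have [pM cM] := partition_merge pP AP BP AB.
rewrite subn1 -cM; apply/leq_strong_in_domatic_number.
apply/strong_in_domatic_partitionP; split=> // S /setU1P[-> | /setD1P[SB /setD1P[SA SP]]].
  split=> // u; rewrite inE negb_or => /andP[_ uB].
  have [|dB _] := PS B BP _; first by rewrite eq_sym.
  by have [v vB uv] := dB u uB; exists v; rewrite // inE vB orbT.
by have [dS sS] := PS S SP SA; split=> //; apply: sS.
Qed.

(** * Deletion of an arc *)

Lemma strong_in_domatic_partition_del_arc (D : digraph) (a : D * D)
    (P : {set {set D}}) :
  @strong_in_domatic_partition (del_arc a) P -> strong_in_domatic_partition P.
Proof.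
move=> /strong_in_domatic_partitionP[pP PS].
apply/strong_in_domatic_partitionP; split=> // S /PS[dS sS]; split.
  by move=> u /dS[v vS /andP[uv _]]; exists v.
by apply: strong_on_sub sS => u v _ _ /andP[].
Qed.

Lemma leq_strong_in_domatic_number_del_arc (D : digraph) (a : D * D) :
  strong_in_domatic_number (del_arc a) <= strong_in_domatic_number D.
Proof.
apply/bigmax_leqP=> P /strong_in_domatic_partition_del_arc.
exact: leq_strong_in_domatic_number.
Qed.

Lemma strong_in_domatic_number_del_arc_geq (D : digraph) (a : D * D) :
  1 < strong_in_domatic_number D -> strong (del_arc a) ->
  strong_in_domatic_number D - 1 <= strong_in_domatic_number (del_arc a).
Proof.
case: a => x y d1 sD.
have [P /strong_in_domatic_partitionP[pP PS] cP] :=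
  strong_in_domatic_number_attained (ltnW d1).
rewrite -cP; pose e := @adj D; pose e' := remove e (x, y).
have cvP u : u \in cover P by rewrite (cover_partition pP) inE.
have tP := partition_trivIset pP.
have uniqP S S' u : S \in P -> S' \in P -> u \in S -> u \in S' -> S = S'.
  by move=> SP S'P uS uS'; rewrite -(def_pblock tP SP uS) -(def_pblock tP S'P uS').
pose A := pblock P y; have AP : A \in P by rewrite pblock_mem.
have yA : y \in A by rewrite mem_pblock.
have yN S : S \in P -> S != A -> y \notin S.
  by move=> SP; apply: contra => yS; apply/eqP/(uniqP _ _ y).
(* Classes other than [A] miss the head [y], so the deletion does not affect them. *)
have otherP : {in P, forall S, S != A -> dominated_by e' S /\ strong_on e' S}.
  move=> S SP SA; have [dS sS] := PS S SP; have yS := yN S SP SA.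
  split; first by apply: dominated_by_remove; rewrite ?yS ?orbT.
  by apply: strong_on_remove; rewrite // (negPf yS) andbF.
have [dA sA] := PS A AP.
(* Common end of both cases: [v w] is an arc from [B] to [A], and domination of [w] by [B] gives an
   arc back. *)
have mergeP B v w : B \in P -> B != A ->
    {in A &, forall s t, connect (restrict e' (A :|: B)) s t} ->
    v \in B -> w \in A -> e' v w ->
    #|P| - 1 <= strong_in_domatic_number (del_arc (x, y)).
  move=> BP BA cA vB wA vw; have [dB sB] := otherP B BP BA.
  apply: (@leq_merge_strong_in_domatic_number (del_arc (x, y)) P A B) => //.
  - by rewrite eq_sym.
  - by move=> S SP SA; have [] := otherP S SP SA.
  have wB : w \notin B by apply: contra BA => wB; apply/eqP/(uniqP _ _ w).
  have [z zB wz] := dB w wB.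
  apply: (connect_setU (x := w) (y := z) (z := v) (w := w)) => //.
  - by move=> s t sB' tB'; apply: connect_restrictS (sB s t sB' tB'); apply: subsetUr.
  - by apply: connect1; rewrite /restrict !inE wA zB orbT.
  by apply: connect1; rewrite /restrict !inE wA vB orbT.
have [xA|xA] := boolP (x \in A); last first.
  have [P2|P2] := leqP #|P| 2.
    apply: leq_trans (_ : 1 <= _); first by rewrite leq_subLR.
    exact: (@strong_in_domatic_number_gt0 (del_arc (x, y)) x).
  (* A third class avoids [x], so no arc from it to [A] is the deleted one. *)
  have /card_gt0P[B] : 0 < #|P :\ A :\ pblock P x|.
    move: P2; rewrite (cardsD1 A P) AP (cardsD1 (pblock P x) (P :\ A)).
    by case: (_ \in _); rewrite ?add1n ?add0n !ltnS // => /ltnW.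
  case/setD1P=> Bx /setD1P[BA BP]; have /set0Pn[v vB] := partition_neq0 pP BP.
  have vA : v \notin A by apply: contra BA => vA; apply/eqP/(uniqP _ _ v).
  have [w wA vw] := dA v vA; apply: (mergeP B v w) => //.
    have sA' : strong_on e' A by apply: strong_on_remove; rewrite // (negPf xA).
    by move=> s t As At; apply: connect_restrictS (sA' s t As At); apply: subsetUl.
  apply/andP; split=> //; apply: contra Bx => /eqP[vx _]; apply/eqP/(uniqP _ _ x) => //.
  - by rewrite pblock_mem.
  - by rewrite -vx.
  by rewrite mem_pblock.
have dA' : dominated_by e' A by apply: dominated_by_remove; rewrite ?xA.
pose W := [set w in A | connect (restrict e' A) w y].
have yW : y \in W by rewrite inE yA /=.
(* If [x] still reaches [y] inside [A], the deleted arc can be bypassed and [P] itself survives. *)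
have [xW|xW] := boolP (x \in W).
  apply: leq_trans (leq_subr _ _) _.
  apply/leq_strong_in_domatic_number/strong_in_domatic_partitionP; split=> // S SP.
  have [->|] := eqVneq S A; last exact: otherP.
  by split=> //; apply: connect_on_remove => //; move: xW; rewrite inE => /andP[].
have /strongP/(_ x y) := sD => /connect_enters/(_ xW yW)[z [w [zW wW zw]]].
have /andP[wA wy] : (w \in A) && connect (restrict e' A) w y by rewrite inE in wW.
(* Otherwise [z] would reach [y] inside [A] through [w], and so lie in [W]. *)
have zA : z \notin A.
  apply: contra zW => zA; rewrite inE zA /=.
  by apply: connect_trans (connect1 _) wy; apply/and3P.
pose B := pblock P z; have BP : B \in P by rewrite pblock_mem.
have zB : z \in B by rewrite mem_pblock.
have BA : B != A by apply: contra zA => /eqP<-.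
apply: (mergeP B z w) => //; apply: connect_on_remove => //; first exact: subsetUl.
have [dB sB] := otherP B BP BA.
have xB : x \notin B by apply: contra BA => xB; apply/eqP/(uniqP _ _ x).
(* The detour from [x] to [y]: the arc to [b], a walk inside [B] to [z], the arc to [w], then a walk
   inside [A]. *)
have [b bB xb] := dB x xB.
apply: connect_trans (_ : connect _ x b) _.
  by apply: connect1; rewrite /restrict !inE xA bB orbT.
apply: connect_trans (connect_restrictS (subsetUr A B) (sB b z bB zB)) _.
apply: connect_trans (connect_restrictS (subsetUl A B) wy).
by apply: connect1; rewrite /restrict !inE wA zB orbT.
Qed.

Theorem theorem4 (D : digraph)
    (hd : 2 <= strong_in_domatic_number D)
    (hs : forall a : D * D, a \in arcs D -> strong (del_arc a)) :
  strong_in_domatic_critical D <->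
  (forall P : {set {set D}},
     strong_in_domatic_partition P -> #|P| = strong_in_domatic_number D ->
     (forall (S : {set D}), S \in P ->
        forall a : induced S * induced S,
          a \in arcs (induced S) -> ~~ strong (del_arc a)) /\
     (forall (S : {set D}), S \in P ->
        forall u : D, u \notin S -> #|S :&: out_nbrs u| = 1)).
Proof.
split=> [crit P /strong_in_domatic_partitionP[pP PS] cP | H [x y] xyD].
  have uniqP S S' u : S \in P -> S' \in P -> u \in S -> u \in S' -> S' = S.
    have tP := partition_trivIset pP; move=> SP S'P uS uS'.
    by rewrite -(def_pblock tP SP uS) -(def_pblock tP S'P uS').
  (* Only the class of the head can be damaged; if it survives, so does the whole of [P], against
     criticality. *)
  have not_del S x y : S \in P -> y \in S -> (x, y) \in arcs D ->
      dominated_by (remove (@adj D) (x, y)) S ->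
      strong_on (remove (@adj D) (x, y)) S -> False.
    move=> SP yS xyD dS sS; have [_ E] := crit _ xyD.
    suff : #|P| <= strong_in_domatic_number (del_arc (x, y)).
      by rewrite E cP leqNgt subn1 ltn_predL (ltnW hd).
    apply/leq_strong_in_domatic_number/strong_in_domatic_partitionP.
    split=> // S' S'P; have [-> //|S'S] := eqVneq S' S.
    have yS' : y \notin S' by apply: contra S'S => yS'; apply/eqP/(uniqP _ _ y).
    have [dS' sS'] := PS S' S'P; split.
      by apply: dominated_by_remove; rewrite ?yS' ?orbT.
    by apply: strong_on_remove; rewrite // (negPf yS') andbF.
  split=> S SP; have [dS sS] := PS S SP.
    move=> [x y] xyS; apply/negP=> /strong_del_inducedP /= s'S.
    apply: (not_del S (val x) (val y)) => //.
    - exact: valP.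
    - by move: xyS; rewrite !inE.
    by apply: dominated_by_remove; rewrite ?(valP x).
  move=> u uS; have [v vS uv] := dS u uS; apply/eqP; rewrite eqn_leq.
  apply/andP; split; last by apply/card_gt0P; exists v; rewrite !inE vS.
  rewrite leqNgt; apply/negP=> /card_gt1P[w [z []]].
  rewrite !inE => /andP[wS uw] /andP[zS uz] wz.
  (* Without the arc to [w], the vertex [u] is still dominated through [z]; strength of [S] is
     untouched since [u] lies outside. *)
  apply: (not_del S u w) => //; first by rewrite inE.
    move=> t tS; have [tu|tu] := eqVneq t u.
      by exists z; rewrite // /remove tu uz xpair_eqE eqxx eq_sym.
    by have [s sS' ts] := dS t tS; exists s; rewrite // /remove ts xpair_eqE (negPf tu).
  by apply: strong_on_remove; rewrite // (negPf uS).
split; first exact: hs.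
have ge := strong_in_domatic_number_del_arc_geq hd (hs _ xyD).
apply/eqP; rewrite eqn_leq ge andbT leqNgt; apply/negP=> lt.
(* If the number does not drop, it is unchanged, so an optimal partition after the deletion is
   optimal for [D] and [H] applies to it. *)
have E : strong_in_domatic_number (del_arc (x, y)) = strong_in_domatic_number D.
  apply/eqP; rewrite eqn_leq leq_strong_in_domatic_number_del_arc.
  by move: lt; rewrite subn1 prednK // ltnW.
have [|P PD' cP] := @strong_in_domatic_number_attained (del_arc (x, y)).
  by rewrite E ltnW.
have PD : @strong_in_domatic_partition D P.
  exact: strong_in_domatic_partition_del_arc PD'.
have [b1 b2] := H P PD (etrans cP E).
have [pP PS] := strong_in_domatic_partitionP _ PD'.
have ycP : y \in cover P by rewrite (cover_partition pP) inE.
pose S : {set D} := pblock P y; have SP : S \in P by rewrite pblock_mem.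
have yS : y \in S by rewrite mem_pblock.
have [dS sS] := PS S SP; have xy : adj x y by rewrite inE in xyD.
have [xS|xS] := boolP (x \in S).
  pose a : induced S * induced S := (Sub x xS, Sub y yS).
  have aS : a \in arcs (induced S) by rewrite inE.
  by case/negP: (b1 S SP a aS); apply/strong_del_inducedP.
(* After the deletion [x] still has an out-neighbor [v] in [S]; it differs from [y], which gives two
   in [D]. *)
have [v vS /andP[xv vy]] := dS x xS.
suff : 1 < #|S :&: out_nbrs x| by rewrite b2.
apply/card_gt1P; exists v, y; rewrite !inE vS yS xv xy; split=> //.
by apply: contra vy => /eqP->.
Qed.
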